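(* Let $\Upsilon$ denote any one of the Menger, Hurewicz or Rothberger properties. Let $f:X\to Y$ be an injective mapping from a set $X$ onto a uniform space $(Y,\mathbb{V})$, and equip $X$ with the uniformity $f^{-1}(\mathbb{V})$ induced by $f$. If $(Y,\mathbb{V})$ is locally $\Upsilon$-bounded, then $(X,f^{-1}(\mathbb{V}))$ is also locally $\Upsilon$-bounded.
   Context: A uniformity on a set $X$ is a nonempty family $\mathbb{U}$ of symmetric subsets of $X\times X$ containing the diagonal $\Delta=\{(x,x):x\in X\}$ (entourages) such that: (i) if $U\in\mathbb{U}$ and $V\supseteq U$ is a symmetric subset of $X\times X$, then $V\in\mathbb{U}$; (ii) $U,V\in\mathbb{U}$ implies $U\cap V\in\mathbb{U}$; (iii) for every $U\in\mathbb{U}$ there is $V\in\mathbb{U}$ with $V\circ V\subseteq U$; (iv) $\bigcap\mathbb{U}=\Delta$. The pair $(X,\mathbb{U})$ is a uniform space. For $U\in\mathbb{U}$, $x\in X$, $F\subseteq X$: $U[x]=\{y\in X:(x,y)\in U\}$ and $U[F]=\bigcup_{x\in F}U[x]$. A subset $Y\subseteq X$ is a subspace with the relative uniformity $\mathbb{U}_Y=\{(Y\times Y)\cap U:U\in\mathbb{U}\}$. For an injective mapping $f:X\to Y$ into a uniform space $(Y,\mathbb{V})$, $f^{-1}(\mathbb{V})$ is the uniformity on $X$ generated by the base $\{g^{-1}(V):V\in\mathbb{V}\}$, where $g=f\times f:X\times X\to Y\times Y$, $g(x,y)=(f(x),f(y))$. A uniform space $(X,\mathbb{U})$ is: ${\sf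 M}$-bounded (the case $\Upsilon$ = Menger) if for each sequence $(U_n)_{n\in\mathbb{N}}$ in $\mathbb{U}$ there are finite $F_n\subseteq X$ with $\bigcup_nU_n[F_n]=X$; ${\sf H}$-bounded ($\Upsilon$ = Hurewicz) if for each sequence $(U_n)$ in $\mathbb{U}$ there are finite $F_n\subseteq X$ such that each $x\in X$ belongs to $U_n[F_n]$ for all but finitely many $n$; ${\sf R}$-bounded ($\Upsilon$ = Rothberger) if for each sequence $(U_n)$ in $\mathbb{U}$ there are $x_n\in X$ with $\bigcup_nU_n[x_n]=X$. ''$\Upsilon$-bounded'' denotes the corresponding one of these properties. $X$ is locally $\Upsilon$-bounded if for each $x\in X$ there is $U\in\mathbb{U}$ such that $U[x]$ is a $\Upsilon$-bounded subspace of $X$. *)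

(* Defs.v *)
From HB Require Import structures.
From mathcomp Require Import all_boot all_order all_algebra.
From mathcomp Require Import all_classical topology.

Set Implicit Arguments.
Unset Strict Implicit.
Unset Printing Implicit Defensive.

Local Open Scope classical_set_scope.
Local Open Scope relation_scope.

(* The library's entourages need not be symmetric, and a [uniformType] need not
   be separated.  A uniformity in the sense used here consists of symmetric
   entourages only, with intersection the diagonal: it is [uniformity X] for a
   [uniformType] X such that [separated_uniformity X] (the library's entourages
   are then the arbitrary supersets of its members). *)
Definition uniformity (X : uniformType) : set_system (X * X) :=
  [set U | entourage U /\ U^-1 = U].

Arguments uniformity : clear implicits.

Definition separated_uniformity (X : uniformType) : Prop :=
  \bigcap_(U in uniformity X) U = diagonal.

(* U[F]; the set U[x] is [xsection U x]. *)
Definition ent_image (X : Type) (U : set (X * X)) (F : set X) : set X :=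
  \bigcup_(x in F) xsection U x.

Inductive selection_property := Menger | Hurewicz | Rothberger.

Definition menger_bounded (X : uniformType) : Prop :=
  forall U : nat -> set (X * X), (forall n, uniformity X (U n)) ->
  exists F : nat -> set X, (forall n, finite_set (F n)) /\
    \bigcup_n ent_image (U n) (F n) = setT.

Definition hurewicz_bounded (X : uniformType) : Prop :=
  forall U : nat -> set (X * X), (forall n, uniformity X (U n)) ->
  exists F : nat -> set X, (forall n, finite_set (F n)) /\
    forall x : X, \forall n \near \oo, ent_image (U n) (F n) x.

Definition rothberger_bounded (X : uniformType) : Prop :=
  forall U : nat -> set (X * X), (forall n, uniformity X (U n)) ->
  exists x : nat -> X, \bigcup_n xsection (U n) (x n) = setT.

Definition bounded_for (S : selection_property) (X : uniformType) : Prop :=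
  match S with
  | Menger => menger_bounded X
  | Hurewicz => hurewicz_bounded X
  | Rothberger => rothberger_bounded X
  end.

(* The library's [subspace A] keeps the whole carrier X, so the subspace with
   carrier A is the type of elements of A with the initial uniformity of the
   inclusion; see [uniformity_relative]. *)
Definition relative (X : uniformType) (A : set X) : uniformType :=
  initial_topology (set_val : A -> X).

Definition locally_bounded_for (S : selection_property) (X : uniformType) :
    Prop :=
  forall x : X, exists2 U : set (X * X),
    uniformity X U & bounded_for S (relative (xsection U x)).

Local Notation sqmap f := (fun p => (f p.1, f p.2)).

Lemma uniformity_core (X : uniformType) (U : set (X * X)) :
  entourage U -> uniformity X (U `&` U^-1).
Proof.
move=> entU; split; first by apply: filterI => //; exact: entourage_inv.
by apply/seteqP; split=> -[x y] [].
Qed.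

Lemma uniformity_initial (X : choiceType) (Y : uniformType) (f : X -> Y) :
  uniformity (initial_topology f) =
  [set U | U^-1 = U /\
    exists2 V, uniformity Y V & sqmap f @^-1` V `<=` U].
Proof.
apply/seteqP; split=> U /=.
  move=> [[V entV VU] Usym]; split=> //; exists (V `&` V^-1).
    exact: uniformity_core.
  by move=> [x y] [Vxy _]; exact: VU.
by move=> [Usym [V [entV _] VU]]; split=> //; exists V.
Qed.

Lemma uniformity_relative (X : uniformType) (A : set X) :
  [set (sqmap (set_val : A -> X) @` U)%classic | U in uniformity (relative A)] =
  [set (A `*` A) `&` V | V in uniformity X].
Proof.
apply/seteqP; split=> W /= [].
  move=> U; rewrite /relative uniformity_initial => -[Usym [V unifV VU]] <-.
  pose I := [set sqmap (set_val : A -> X) p | p in U].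
  have Isym x y : I (x, y) -> I (y, x).
    move=> [[a b] Uab [<- <-]]; exists (b, a) => //.
    by move: Uab; rewrite -{1}Usym.
  exists (V `|` I).
    have [entV Vsym] := unifV; split.
      by apply: filterS entV => ? ?; left.
    apply/seteqP; split=> -[x y] /= [].
    - by move=> Vyx; left; rewrite -Vsym.
    - by move=> /Isym; right.
    - by move=> Vxy; left; rewrite -Vsym in Vxy.
    - by move=> /Isym; right.
  apply/seteqP; split=> -[x y] /=.
    move=> [[Ax Ay] [Vxy|//]].
    exists (SigSub (mem_set Ax) : A, SigSub (mem_set Ay) : A) => //.
    by apply: VU; rewrite /= !set_valE.
  move=> Ixy; split; last by right.
  by case: Ixy => [[a b] _ [<- <-]]; split; exact: set_valP.
move=> V unifV <-; exists (sqmap (set_val : A -> X) @^-1` V).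
  rewrite /relative uniformity_initial; split; last by exists V.
  have [_ Vsym] := unifV.
  by rewrite -{2}Vsym.
apply/seteqP; split=> -[x y] /=.
  by move=> [[a b] Vab [<- <-]]; split=> //; split; exact: set_valP.
move=> [[Ax Ay] Vxy].
by exists (SigSub (mem_set Ax) : A, SigSub (mem_set Ay) : A).
Qed.

Lemma separated_initial (X : choiceType) (Y : uniformType) (f : X -> Y) :
  injective f -> separated_uniformity Y -> separated_uniformity (initial_topology f).
Proof.
move=> finj sepY; apply/seteqP; split=> -[x y].
  move=> xy; apply/diagonalP; apply: finj.
  suff : diagonal (f x, f y) by move/diagonalP.
  rewrite -sepY => V unifV; apply: (xy (sqmap f @^-1` V)).
  rewrite uniformity_initial; split; last by exists V.
  by have [_ Vsym] := unifV; rewrite -{2}Vsym.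
move=> /diagonalP -> U [entU _]; exact: entourage_refl.
Qed.

(* Main.v *)
(* Each of the three boundedness properties passes backwards along a surjection
   g : Z -> W whose uniformity on Z is generated by preimages: choose a section
   h of g and use the images under h of the finite sets (or points) found in W.
   A neighbourhood section of x in X is the f-preimage of one of f x in Y, so f
   restricts to such a surjection between the corresponding subspaces. *)
Require Import Defs.
From mathcomp Require Import all_boot all_order all_algebra.
From mathcomp Require Import all_classical topology.

Local Open Scope classical_set_scope.

Lemma bounded_for_surjection (S : selection_property) (Z W : uniformType)
    (g : Z -> W) :
  (forall w, exists z, g z = w) ->
  (forall U, uniformity Z U -> exists2 V, uniformity W V &
    forall a b, V (g a, g b) -> U (a, b)) ->
  bounded_for S W -> bounded_for S Z.
Proof.
move=> /choice[h hK] gunif.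
(* Shared by the three cases: each [U n] is traded for a [V n] on [W] such that any [z] with [g z]
   in the [V n]-ball around [w] lies in the [U n]-ball around [h w]. *)
have pull (U : nat -> set (Z * Z)) : (forall n, uniformity Z (U n)) ->
    exists V : nat -> set (W * W), (forall n, uniformity W (V n)) /\
      forall n w z, xsection (V n) w (g z) -> xsection (U n) (h w) z.
  move=> unifU.
  have /choice[V VP] n : exists V, uniformity W V /\
      forall a b, V (g a, g b) -> U n (a, b).
    by have [V ? ?] := gunif _ (unifU n); exists V.
  exists V; split=> [n|n w z]; first exact: (VP n).1.
  (* Writing [w] as [g (h w)] gives the pair the form required by [gunif]. *)
  by rewrite -{1}(hK w) => /xsectionP Vwz; apply/xsectionP; exact: (VP n).2.
have imageh (U : set (Z * Z)) (V : set (W * W)) (F : set W) z :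
    (forall w, xsection V w (g z) -> xsection U (h w) z) ->
    ent_image V F (g z) -> ent_image U (h @` F) z.
  by move=> VU [w Fw /VU Uwz]; exists (h w) => //; exists w.
case: S => bW U /pull[V [/bW]].
- move=> [F [finF cover]] VU; exists (fun n => h @` F n); split.
    by move=> n; exact: finite_image.
  apply/seteqP; split=> // z _.
  have [n _ Fz] : (\bigcup_n ent_image (V n) (F n)) (g z) by rewrite cover.
  by exists n => //; apply: imageh Fz => w; exact: VU.
- move=> [F [finF cover]] VU; exists (fun n => h @` F n); split.
    by move=> n; exact: finite_image.
  move=> z; apply: filterS (cover (g z)) => n.
  by apply: imageh => w; exact: VU.
- move=> [x cover] VU; exists (h \o x); apply/seteqP; split=> // z _.
  have [n _ xz] : (\bigcup_n xsection (V n) (x n)) (g z) by rewrite cover.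
  by exists n => //; exact: VU.
Qed.

(** Serves both for [f] itself and for the inclusion of a ball of [Y] into [Y]. *)
Lemma uniformity_preimage (X : choiceType) (Y : uniformType) (f : X -> Y)
    (V : set (Y * Y)) :
  uniformity Y V ->
  uniformity (initial_topology f) [set p | V (f p.1, f p.2)].
Proof.
move=> unifV; rewrite uniformity_initial; split; last by exists V.
have [_ Vsym] := unifV.
by rewrite -{2}Vsym.
Qed.

Theorem proposition4p5 (S : selection_property) (X : choiceType)
    (Y : uniformType) (sepY : separated_uniformity Y) (f : X -> Y)
    (f_inj : injective f) (f_onto : range f = [set: Y])
    (locY : locally_bounded_for S Y) :
  locally_bounded_for S (initial_topology f).
Proof.
move=> x; have [U unifU bU] := locY (f x).
exists [set p | U (f p.1, f p.2)]; first exact: uniformity_preimage.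
set A := xsection _ x.
have fA (a : A) : xsection U (f x) (f (set_val a)).
  by have /xsectionP Ua := set_valP a; apply/xsectionP.
pose g (a : relative A) : relative (xsection U (f x)) :=
  SigSub (mem_set (fA a)).
apply: (bounded_for_surjection S _ _ g) bU => [[y yU]|V].
  (* Membership in [A] depends only on the image under [f], so any [f]-preimage of [y] lies in
     [A]. *)
  have [a _ fay] : range f y by rewrite f_onto.
  have Aa : A a.
    by apply/xsectionP; rewrite /= fay; apply/xsectionP; exact: set_mem yU.
  by exists (SigSub (mem_set Aa) : A); apply: val_inj.
(* The uniformity of [relative A] is induced in two stages, by the inclusion into [X] and then by
   [f]. Undoing both yields [V2] on [Y], whose trace on the ball around [f x] is the witness. *)
rewrite {1}/relative uniformity_initial => -[_ [V1]].
rewrite uniformity_initial => -[_ [V2 unifV2 V21]] V1V.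
exists [set p | V2 (set_val p.1, set_val p.2)].
  exact: uniformity_preimage.
by move=> a b V2ab; apply: V1V; exact: V21.
Qed.
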